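(* Let $\gamma\in[0,1]$ and a level $\alpha$ be fixed, and let constants $\alpha_1\le\alpha_2\le\cdots\le\alpha_s$ be given. Write $m(j)=\lfloor\gamma j\rfloor+1$ and $x\vee y=\max\{x,y\}$. For integers $1\le n\le s$ define $$S_2(\gamma,s,n)=n\,\alpha_1+n\sum_{\substack{n-s+1<k\le n\\ n\ge m(s-n+k)}}\frac{\alpha_{s-n+k}-\alpha_{s-n+k-1}}{k\vee m(s-n+k)},\qquad D_2(\gamma,s)=\max_{1\le n\le s}S_2(\gamma,s,n),$$ where the sum is over integers $k$. For testing $H_i:P\in\omega_i$, $i=1,\dots,s$, suppose the $p$-values $\hat p_i$ satisfy $P\{\hat p_i\le u\}\le u$ for any $u\in(0,1)$ and any $P\in\omega_i$. Consider the stepup procedure with critical values $\alpha_i''=\alpha\alpha_i/D_2(\gamma,s)$, $i=1,\dots,s$. (i) Then $P\{FDP>\gamma\}\le\alpha$. (ii) Moreover, for any stepup procedure with critical values of the form $\tilde\alpha_i=\alpha\alpha_i/D'$ for some constant $D'$ that satisfies $P\{FDP>\gamma\}\le\alpha$, we have $\alpha_i''\ge\tilde\alpha_i$ for each $i$.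
   Context: Setting: data are generated from some $P\in\Omega$; the hypothesis $H_i$ is the statement $P\in\omega_i$ with $\omega_i\subseteq\Omega$. The set of true null hypotheses is $I(P)=\{i:P\in\omega_i\}$. Each $\hat p_i$ is a $p$-value for testing $H_i$. Nothing is assumed about the joint distribution (dependence structure) of the $p$-values. Accordingly, a procedure ''satisfies $P\{FDP>\gamma\}\le\alpha$'' means that this inequality holds whichever null hypotheses are true and whatever the joint distribution of $(\hat p_1,\dots,\hat p_s)$, subject only to $P\{\hat p_i\le u\}\le u$ for all $u\in(0,1)$ for each true $H_i$. Stepup procedure with nondecreasing critical values $c_1\le\cdots\le c_s$: order the $p$-values as $\hat p_{(1)}\le\cdots\le\hat p_{(s)}$ with corresponding hypotheses $H_{(1)},\dots,H_{(s)}$. If $\hat p_{(s)}\le c_s$, reject all hypotheses; otherwise reject $H_{(1)},\dots,H_{(r)}$, where $r$ is the smallest index with $\hat p_{(s)}>c_s,\dots,\hat p_{(r+1)}>c_{r+1}$; if $\hat p_{(r)}>c_r$ for all $r$, reject nothing. The false discovery proportion $FDP$ is the number of rejected hypotheses $H_i$ with $i\in I(P)$ divided by the total number of rejected hypotheses, and is defined to be $0$ if no hypothesis is rejected.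
   Formalization: The constants are taken nonnegative (α_1 ≥ 0) since (i) can fail for negative ones; the level satisfies 0<α<1; and part (ii) is stated for γ<1, since for γ=1 the event FDP>γ is impossible and every constant D' is admissible. *)

(* Defs.v *)
From HB Require Import structures.
From mathcomp Require Import all_boot all_order all_algebra.
From mathcomp Require Import all_classical all_reals all_analysis.

Set Implicit Arguments.
Unset Strict Implicit.
Unset Printing Implicit Defensive.

Import Order.TTheory GRing.Theory Num.Theory.

Local Open Scope classical_set_scope.
Local Open Scope ring_scope.

(* The s hypotheses are indexed by 'I_s.  Critical values, and the constants   *)
(* they are built from, are functions c : nat -> R of which only the values    *)
(* c 1, ..., c s are used, so that their indices agree with the ranks of the   *)
(* ordered p-values.                                                           *)

Section Stepup.
Context {R : realType} {s : nat}.
Implicit Types (c : nat -> R) (p : 'I_s -> R).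

(* H_(1), ..., H_(s) *)
Definition ordered_hyps p : seq 'I_s :=
  sort (fun i j => p i <= p j) (enum 'I_s).

(* \hat p_(j), for 1 <= j <= s *)
Definition ordered_pval p (j : nat) : R :=
  nth 0 [seq p i | i <- ordered_hyps p] j.-1.

(* The smallest r in {0, ..., s} with \hat p_(j) > c_j for all r < j <= s.     *)
(* The rank r = s qualifies vacuously: s is returned iff \hat p_(s) <= c_s, and   *)
(* 0 is returned iff \hat p_(j) > c_j for all j.                               *)
Definition stepup_num c p : nat :=
  [arg min_(r < (ord_max : 'I_s.+1)
     | [forall j : 'I_s.+1, (r < j)%N ==> (c j < ordered_pval p j)%R]) (r : nat)]%N.

Definition stepup c p : {set 'I_s} :=
  [set i in take (stepup_num c p) (ordered_hyps p)]%SET.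

Definition FDP (I rejected : {set 'I_s}) : R :=
  if rejected == finset.set0 then 0
  else #|rejected :&: I|%SET%:R / #|rejected|%:R.

End Stepup.

Definition true_nulls {R : realType} {s : nat} {d : measure_display}
    {T : measurableType d} (omega : 'I_s -> set (probability T R))
    (P : probability T R) : {set 'I_s} :=
  [set i | `[< omega i P >]]%SET.

(* The stepup procedure with critical values c satisfies P{FDP > gamma} <= alpha *)
(* in every model Omega, for all hypotheses omega_i \subseteq Omega and all      *)
(* p-values: nothing is assumed on their joint distribution, and their marginals *)
(* are constrained only under the true null hypotheses.                          *)
Definition stepup_controls_FDP {R : realType} (s : nat) (gamma alpha : R)
    (c : nat -> R) : Prop :=
  forall (d : measure_display) (T : measurableType d)
    (Omega : set (probability T R)) (omega : 'I_s -> set (probability T R))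
    (p : 'I_s -> {mfun T >-> R}),
    (forall i, omega i `<=` Omega) ->
    (forall i (P : probability T R), omega i P ->
       forall u : R, 0 < u < 1 -> (P [set t | (p i t <= u)%R] <= u%:E)%E) ->
    forall P : probability T R, Omega P ->
      (P [set t | (gamma < FDP (true_nulls omega P)
                             (stepup c (fun i => p i t)))%R] <= alpha%:E)%E.

Section Constants.
Context {R : realType}.
Implicit Types (gamma : R) (a : nat -> R).

Definition mfloor gamma (j : nat) : int := Num.floor (gamma * j%:R) + 1.

(* The sum over integers k with n - s + 1 < k <= n is indexed by j = s - n + k, *)
(* which runs from 2 to s; k itself may be negative.                            *)
Definition S2 gamma a (s n : nat) : R :=
  n%:R * a 1%N +
  n%:R * \sum_(2 <= j < s.+1 | mfloor gamma j <= n%:Z)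
    (a j - a j.-1)
      / (Num.max (n%:Z - s%:Z + j%:Z) (mfloor gamma j))%:~R.

(* For s >= 1, the default value S2 gamma a s 1 is one of the terms. *)
Definition D2 gamma a (s : nat) : R :=
  \big[Num.max/S2 gamma a s 1]_(1 <= n < s.+1) S2 gamma a s n.

End Constants.

(* Main.v *)
Require Import Defs.
From HB Require Import structures.
From mathcomp Require Import all_boot all_order all_algebra.
From mathcomp Require Import all_classical all_reals all_analysis.
From mathcomp Require Import measurable_realfun.
From mathcomp Require Import ring lra zify.

Set Implicit Arguments.
Unset Strict Implicit.
Unset Printing Implicit Defensive.

Import Order.TTheory GRing.Theory Num.Theory.

Local Open Scope ring_scope.

(** Write [m j] for the least number of false rejections that makes the false
    discovery proportion exceed [gamma] when [j] hypotheses are rejected, and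
    let [n] of the [s] hypotheses be true.  If the stepup procedure rejects
    [j] hypotheses and FDP > gamma, then at least [m j] rejections are false;
    at least [j - (s - n)] are false as well, since only [s - n] hypotheses are
    false.  Hence at least [b j := max (n + j - s) (m j)] p-values of true
    nulls lie below [c j].  Everything rests on the sharp bound, over all
    dependence structures, for the probability that this happens for some
    [j]: when [gamma < 1], [n > 0] and the critical values are nonnegative and
    nondecreasing, it is [min 1 (S2 c n)], where

      S2 c n = n * sum over j with m j <= n of (c j - c (j - 1)) / b j

    and [c 0 = 0].  So, as [alpha < 1], a stepup procedure controls the FDP
    exactly when [S2 c n <= alpha] for all [n] from 1 to [s], and both claims
    follow because [S2] is homogeneous in [c]: dividing by [D2] is admissible,
    and any admissible positive divisor is at least [D2].

    The upper bound ([stepup_FDP_le]) is a Markov inequality.  A true null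
    whose p-value is above [c (j - 1)] and at most [c j] is charged [1 / b j],
    for the ranks with [m j <= n].  As [b] is nondecreasing, on the event the total charge is at least [b j * (1 / b j)]
    ([FDP_certificate]).  The charge is a nonnegative combination of the
    indicators of [p <= c j], whose probabilities are at most [c j], and a
    summation by parts bounds the expected charge by [S2 c n]
    ([S2_price]).

    The bound is attained ([finite_least_favourable]) when nothing is wasted:
    rank [j] is drawn with probability proportional to
    [n * (c j - c (j - 1)) / b j]; then exactly [b j] true nulls, each chosen
    with the same probability, and [j - b j] false ones get the p-value [c j],
    and all the other p-values exceed [c s].  Exactly [j] hypotheses are then
    rejected, [b j] of them falsely, while each true null receives the p-value [c j] with
    probability at most [c j - c (j - 1)].  Choosing the true nulls by a rotation
    of [b j] consecutive places makes the sample space finite; the whole model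
    is realized on the natural numbers ([stepup_controls_S2]). *)

(** * The stepup procedure in terms of counts *)

Section StepupCounts.
Context {R : realType} {s : nat}.
Implicit Types (c : nat -> R) (p : 'I_s -> R).

Definition count_le p (u : R) : nat := #|[set i | p i <= u]%SET|.

Lemma uniq_ordered_hyps p : uniq (ordered_hyps p).
Proof. by rewrite sort_uniq enum_uniq. Qed.

Lemma size_ordered_hyps p : size (ordered_hyps p) = s.
Proof. by rewrite size_sort size_enum_ord. Qed.

Lemma sorted_ordered_pvals p :
  sorted <=%O [seq p i | i <- ordered_hyps p].
Proof.
rewrite sorted_map; apply: sort_sorted => i j /=.
exact: le_total.
Qed.

Lemma count_ordered_pvals p u :
  count (<= u) [seq p i | i <- ordered_hyps p] = count_le p u.
Proof.
rewrite count_map /ordered_hyps (permP (permEl (perm_sort _ _))).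
rewrite -size_filter /count_le cardE; congr size.
by rewrite enumT; apply: eq_filter => i /=; rewrite inE.
Qed.

Lemma lt_ordered_pval p u j : (0 < j <= s)%N ->
  (u < ordered_pval p j) = (count_le p u < j)%N.
Proof.
case: j => // j /= js; rewrite /ordered_pval /= -count_ordered_pvals ltnS.
have ss := sorted_ordered_pvals p; apply/idP/idP => [|h].
  by apply: contraTT; rewrite -ltnNge -leNgt; exact: nth_count_le.
by apply: nth_count_gt => //; rewrite h size_map size_ordered_hyps.
Qed.

(** The number of rejections is the last rank at which the count of p-values
    under the critical value reaches the rank; stated this way the procedure
    no longer mentions sorting. *)
Lemma stepup_numP c p :
  [/\ (stepup_num c p <= s)%N,
      (stepup_num c p <= count_le p (c (stepup_num c p)))%N
    & forall j, (stepup_num c p < j <= s)%N -> (count_le p (c j) < j)%N].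
Proof.
rewrite /stepup_num; case: arg_minnP => [|r /forallP hr rmin].
  by apply/forallP => j; apply/implyP; rewrite ltnNge -ltnS ltn_ord.
have above j : (r < j <= s)%N -> (count_le p (c j) < j)%N.
  case/andP=> rj js; have := hr (inord j); rewrite inordK ?ltnS // rj /=.
  by rewrite lt_ordered_pval // js andbT; exact: leq_ltn_trans rj.
split=> //; first by rewrite -ltnS.
(* If the count at [c r] were below [r], the rank [r.-1] would qualify too. *)
rewrite leqNgt; apply/negP => rlt.
have r0 : (0 < r)%N by exact: leq_ltn_trans rlt.
have rs : (r <= s)%N by rewrite -ltnS.
suff /rmin : [forall j : 'I_s.+1,
    ((inord r.-1 : 'I_s.+1) < j)%N ==> (c j < ordered_pval p j)].
  by rewrite inordK; lia.
apply/forallP => j; rewrite inordK; last by lia.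
apply/implyP => rj; rewrite lt_ordered_pval; last by have := ltn_ord j; lia.
have [-> //|jr] := eqVneq (j : nat) r.
by apply: above; have := ltn_ord j; lia.
Qed.

Lemma card_stepup c p : #|stepup c p| = stepup_num c p.
Proof.
have [rs _ _] := stepup_numP c p.
rewrite cardsE (card_uniqP _) ?take_uniq ?uniq_ordered_hyps //.
by rewrite size_takel ?size_ordered_hyps.
Qed.

Lemma stepup_le c p i : i \in stepup c p -> p i <= c (stepup_num c p).
Proof.
have [rs rc _] := stepup_numP c p.
rewrite inE => /(nthP i)[k]; rewrite size_takel ?size_ordered_hyps // => kr.
rewrite nth_take // => <-.
rewrite -(nth_map _ 0) ?size_ordered_hyps; last exact: leq_trans rs.
apply: nth_count_le; first exact: sorted_ordered_pvals.
by rewrite count_ordered_pvals; exact: leq_trans rc.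
Qed.

(** A gap in the p-values decides the procedure: from rank [#|A|] on, the counts
    stay at [#|A|], so this is the last rank that is reached.  Both sets
    then have [#|A|] elements and one inclusion is enough. *)
Lemma stepup_eq c p (A : {set 'I_s}) : (0 < #|A|)%N ->
    (forall i, i \in A -> p i = c #|A|) ->
    (forall i j, i \notin A -> (#|A| <= j <= s)%N -> c j < p i) ->
  stepup c p = A.
Proof.
move=> A0 pA pNA; have [rs rc above] := stepup_numP c p.
have As : (#|A| <= s)%N by rewrite -[leqRHS]card_ord max_card.
have leA j : (#|A| <= j <= s)%N ->
    [set i | p i <= c j]%SET \subset A.
  move=> Ajs; apply/fintype.subsetP => i; rewrite inE.
  by apply: contraLR => /pNA /(_ Ajs); rewrite ltNge.
have Ar : (#|A| <= stepup_num c p)%N.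
  rewrite leqNgt; apply/negP => /(conj As)/andP; rewrite andbC => /above.
  rewrite ltnNge => /negP; apply; apply: subset_leq_card.
  by apply/fintype.subsetP => i /pA pi; rewrite inE pi.
have num : stepup_num c p = #|A|.
  apply/eqP; rewrite eqn_leq Ar andbT (leq_trans rc) //.
  by apply: subset_leq_card; apply: leA; rewrite Ar.
apply/eqP; rewrite eqEcard card_stepup num leqnn andbT.
apply/fintype.subsetP => i /stepup_le; rewrite num => pi.
by apply: (fintype.subsetP (leA #|A| _)); rewrite ?leqnn ?As // inE.
Qed.

End StepupCounts.

Section StepupEvents.
Context {R : realType} {s : nat}.
Implicit Types (c : nat -> R) (p q : 'I_s -> R).

(** The rejected set is determined by finitely many comparisons, which is what
    makes events about it measurable. *)
Lemma eq_stepup c p q :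
    (forall i k, (p i <= p k) = (q i <= q k)) ->
    (forall i (j : 'I_s.+1), (p i <= c j) = (q i <= c j)) ->
  stepup c p = stepup c q.
Proof.
move=> ord pos.
have cnt j : (j <= s)%N -> count_le p (c j) = count_le q (c j).
  move=> js; apply: eq_card => i; rewrite !inE.
  by have := pos i (Ordinal (js : (j < s.+1)%N)).
have [ps pc pab] := stepup_numP c p; have [qs qc qab] := stepup_numP c q.
have num : stepup_num c p = stepup_num c q.
  have [lt|lt|//] := ltngtP (stepup_num c p) (stepup_num c q).
    by have := pab _ (introT andP (conj lt qs)); rewrite cnt // ltnNge qc.
  by have := qab _ (introT andP (conj lt ps)); rewrite -cnt // ltnNge pc.
rewrite /stepup /ordered_hyps num.
by have -> : (fun i k => p i <= p k) = (fun i k => q i <= q k) by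
  apply/funext => i; apply/funext => k; exact: ord.
Qed.

Lemma measurable_fin_data {d} {T : measurableType d} (K : finType)
    (b : K -> T -> bool) (A : set T) :
    (forall k, measurable [set t | b k t]) ->
    (forall t t', (forall k, b k t = b k t') -> A t -> A t') ->
  measurable A.
Proof.
move=> mb Ab.
have -> : A = (\bigcup_(f in [set f : {ffun K -> bool} |
    exists2 t, A t & forall k, b k t = f k])
    \bigcap_(k in [set: K]) [set t | b k t = f k])%classic.
  apply/seteqP; split=> [t At|t [f [t' At' bf] /= bt]].
    by exists [ffun k => b k t]; [exists t => // k; rewrite ffunE
                                 | move=> k _ /=; rewrite ffunE].
  by apply: Ab At' => k; rewrite bf bt.
apply: fin_bigcup_measurable => [|f _]; first exact: finite_finset.
apply: fin_bigcap_measurable => [|k _]; first exact: finite_finset.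
case: (f k); first exact: mb.
rewrite (_ : [set t | _] = ~` [set t | b k t])%classic; first exact/measurableC/mb.
by apply/seteqP; split=> t /=; [move=> -> | move/negP/negbTE].
Qed.

Lemma measurable_stepup {d} {T : measurableType d} c (p : 'I_s -> {mfun T >-> R})
    (Q : {set 'I_s} -> bool) :
  measurable [set t | Q (stepup c (fun i => p i t))].
Proof.
pose b (k : ('I_s * 'I_s + 'I_s * 'I_s.+1)%type) t :=
  match k with
  | inl ii => p ii.1 t <= p ii.2 t
  | inr ij => p ij.1 t <= c ij.2
  end.
apply: (@measurable_fin_data _ _ _ b) => [[[i k]|[i j]]|t t' bb] /=.
- rewrite -[X in measurable X]setTI.
  by apply: (measurable_fun_le (f := p i) (g := p k)).
- rewrite -[X in measurable X]setTI.
  by apply: (measurable_fun_le (f := p i) (g := cst (c j))).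
rewrite (@eq_stepup c _ (fun i => p i t')) // => [i k|i j].
  exact: (bb (inl (i, k))).
exact: (bb (inr (i, j))).
Qed.

End StepupEvents.

(** * Counting false rejections *)

Section FalseRejections.
Context {R : realType}.
Implicit Types (gamma : R).

Definition min_false gamma (j : nat) : nat := (Num.truncn (gamma * j%:R)).+1.

Lemma lt_min_false gamma j v : 0 <= gamma ->
  (gamma * j%:R < v%:R) = (min_false gamma j <= v)%N.
Proof.
move=> g0; rewrite /min_false.
by rewrite truncn_lt_nat // mulr_ge0.
Qed.

Lemma mfloorE gamma j : 0 <= gamma -> mfloor gamma j = (min_false gamma j)%:Z.
Proof.
move=> g0; rewrite /mfloor /min_false -addn1 PoszD; congr (_ + _).
by rewrite truncn_floor mulr_ge0 // gez0_abs // floor_ge0 mulr_ge0.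
Qed.

Lemma min_false_le gamma j : 0 <= gamma < 1 -> (0 < j)%N ->
  (min_false gamma j <= j)%N.
Proof.
by move=> /andP[g0 g1] j0; rewrite -lt_min_false // gtr_pMl // ltr0n.
Qed.

Lemma leq_min_false gamma j k : 0 <= gamma -> (j <= k)%N ->
  (min_false gamma j <= min_false gamma k)%N.
Proof.
move=> g0 jk; rewrite -lt_min_false //.
apply: (@le_lt_trans _ _ (gamma * k%:R)); first by rewrite ler_wpM2l // ler_nat.
by rewrite lt_min_false.
Qed.

(** The least number of false rejections compatible with FDP > gamma, when [j]
    of [s] hypotheses are rejected and [n] of the [s] are true.  Truncated
    subtraction is harmless because [min_false] is positive. *)
Definition quota (s n : nat) gamma (j : nat) : nat :=
  maxn (n + j - s) (min_false gamma j).

Lemma quota_gt0 s n gamma j : (0 < quota s n gamma j)%N.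
Proof. by rewrite leq_max orbT. Qed.

Lemma leq_quota s n gamma j k : 0 <= gamma -> (j <= k)%N ->
  (quota s n gamma j <= quota s n gamma k)%N.
Proof. by move=> g0 jk; have := @leq_min_false _ _ _ g0 jk; rewrite /quota; lia. Qed.

Lemma quota_le s n gamma j : 0 <= gamma < 1 -> (n <= s)%N -> (0 < j)%N ->
  (quota s n gamma j <= j)%N.
Proof.
by move=> g01 ns j0; have := @min_false_le _ _ g01 j0; rewrite /quota; lia.
Qed.

Lemma quota_leq_nulls s n gamma j : (j <= s)%N -> (min_false gamma j <= n)%N ->
  (quota s n gamma j <= n)%N.
Proof. by rewrite /quota; lia. Qed.

Lemma quota1 s n gamma : 0 <= gamma < 1 -> (n <= s)%N -> quota s n gamma 1 = 1%N.
Proof.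
move=> g01 ns; apply/eqP.
by rewrite eqn_leq quota_gt0 quota_le.
Qed.

Lemma FDP_gt s gamma (I A : {set 'I_s}) : 0 <= gamma ->
  (gamma < FDP I A) = (min_false gamma #|A| <= #|A :&: I|)%N.
Proof.
move=> g0; rewrite /FDP; case: eqVneq => [->|A0].
  by rewrite finset.set0I !cards0 ltNge g0.
by rewrite -lt_min_false // ltr_pdivlMr // ltr0n card_gt0.
Qed.

Lemma FDP_le1 s (I A : {set 'I_s}) : FDP I A <= 1 :> R.
Proof.
rewrite /FDP; case: eqVneq => [_|A0]; first exact: ler01.
rewrite ler_pdivrMr ?mul1r ?ltr0n ?card_gt0 // ler_nat.
by rewrite subset_leq_card // finset.subsetIl.
Qed.

(** The rank [j] is the number of rejections.  Besides [min_false gamma j], the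
    quota accounts for the rejections that the [s - #|I|] false nulls cannot
    absorb. *)
Lemma FDP_gt_quota s gamma (c : nat -> R) (p : 'I_s -> R) (I : {set 'I_s}) :
    0 <= gamma -> gamma < FDP I (stepup c p) ->
  exists2 j, (0 < j <= s)%N & (min_false gamma j <= #|I|)%N /\
    (quota s #|I| gamma j <= #|[set i in I | (p i <= c j)%R]|%SET)%N.
Proof.
move=> g0; rewrite FDP_gt // card_stepup => mle.
have [rs _ _] := stepup_numP c p.
have r0 : (0 < stepup_num c p)%N.
  rewrite -(card_stepup c p) card_gt0; apply/negP => /eqP e.
  by move: mle; rewrite e finset.set0I cards0.
have subI : stepup c p :&: I \subset [set i in I | p i <= c (stepup_num c p)]%SET.
  apply/fintype.subsetP => i /finset.setIP[ri iI].
  by rewrite inE iI /= stepup_le.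
exists (stepup_num c p); rewrite ?r0 //; split.
  by apply: leq_trans mle _; rewrite subset_leq_card // finset.subsetIr.
apply: leq_trans (subset_leq_card subI); rewrite geq_max mle andbT.
have := cardsUI (stepup c p) I; rewrite card_stepup.
have : (#|stepup c p :|: I| <= s)%N by rewrite -[leqRHS]card_ord max_card.
lia.
Qed.

End FalseRejections.

(** * The constants as Abel sums *)

Section AbelSums.
Context {R : realType}.
Implicit Types (gamma : R) (c v : nat -> R).

(** The convention [c_0 = 0] turns the separate first term of [S2] into the
    summand of index [1]. *)
Definition incr c (j : nat) : R := c j - (if j == 1%N then 0 else c j.-1).

Lemma incr_ge0 s c : 0 <= c 1%N ->
    (forall i j, (1 <= i <= j)%N -> (j <= s)%N -> c i <= c j) ->
  forall j, (0 < j <= s)%N -> 0 <= incr c j.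
Proof.
move=> c1 cnd j /andP[j0 js]; rewrite /incr subr_ge0.
case: eqP => [-> //|j1]; apply: cnd => //; lia.
Qed.

Lemma sum_incr c j : (0 < j)%N -> \sum_(1 <= k < j.+1) incr c k = c j.
Proof.
case: j => // j _; elim: j => [|j IH]; first by rewrite big_nat1 /incr subr0.
by rewrite big_nat_recr //= IH /incr /= addrC subrK.
Qed.

Lemma sum_by_parts c v s : (0 < s)%N ->
  \sum_(1 <= j < s.+1) (v j - v j.+1) * c j =
  \sum_(1 <= j < s.+1) v j * incr c j - v s.+1 * c s.
Proof.
case: s => // s _; elim: s => [|s IH]; first by rewrite !big_nat1 /incr /=; ring.
by rewrite big_nat_recr //= IH [in RHS]big_nat_recr //= /incr /=; ring.
Qed.

Lemma S2E gamma a s n : 0 <= gamma < 1 -> (0 < n <= s)%N ->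
  S2 gamma a s n = n%:R *
    \sum_(1 <= j < s.+1 | (min_false gamma j <= n)%N)
       incr a j / (quota s n gamma j)%:R.
Proof.
move=> g01 /andP[n0 ns]; have /andP[g0 _] := g01.
have s0 : (0 < s)%N by exact: leq_trans ns.
rewrite /S2 -mulrDr [in RHS]big_ltn_cond //.
rewrite (leq_trans (min_false_le g01 (isT : (0 < 1)%N)) n0).
rewrite quota1 // divr1 /incr eqxx subr0; congr (_ * (_ + _)).
rewrite [LHS]big_nat_cond [RHS]big_nat_cond; apply: eq_big => j.
  by rewrite mfloorE // lez_nat.
case/andP=> /andP[j2 _] _; rewrite mfloorE // gtn_eqF //; congr (_ / _).
rewrite /quota -[RHS]/(_%:Z%:~R); congr (_%:~R).
lia.
Qed.

Lemma S2_scale gamma a s n k :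
  S2 gamma (fun j => k * a j) s n = k * S2 gamma a s n.
Proof.
rewrite /S2 mulrDr !mulr_sumr; congr (_ + _); first by ring.
by apply: eq_bigr => j _; rewrite -mulrBr; ring.
Qed.

Lemma S2_le_D2 gamma a s n : (0 < n <= s)%N -> S2 gamma a s n <= D2 gamma a s.
Proof.
move=> ns; rewrite /D2; apply: (@le_bigmax_seq _ _ _ _ _ n) => //.
by rewrite mem_index_iota ltnS.
Qed.

Lemma D2_le gamma a s x : (0 < s)%N ->
  (forall n, (0 < n <= s)%N -> S2 gamma a s n <= x) -> D2 gamma a s <= x.
Proof.
move=> s0 Sx; rewrite /D2 big_seq; apply: bigmax_le; first exact: Sx.
by move=> n; rewrite mem_index_iota ltnS => /Sx.
Qed.

End AbelSums.

(** * The upper bound *)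

Section UpperBound.
Context {R : realType}.
Implicit Types (gamma : R) (c : nat -> R).

(** The charge of a true null whose p-value lies between the critical values of
    ranks [j.-1] and [j].  It vanishes at rank [s.+1] and at the ranks that
    would need more than [n] false rejections, so that the decrements
    [price j - price j.+1] are nonnegative and sum to the price itself. *)
Definition price (s n : nat) gamma (j : nat) : R :=
  if ((j <= s) && (min_false gamma j <= n))%N then (quota s n gamma j)%:R^-1
  else 0.

Lemma price_ge0 s n gamma j : 0 <= price s n gamma j.
Proof. by rewrite /price; case: ifP => // _; rewrite invr_ge0. Qed.

Lemma price_nonincreasing s n gamma j : 0 <= gamma ->
  price s n gamma j.+1 <= price s n gamma j.
Proof.
move=> g0; rewrite {1}/price; case: ifP => [/andP[js mn]|_]; last exact: price_ge0.
rewrite /price (ltnW js) (leq_trans _ mn) ?leq_min_false //.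
by rewrite lef_pV2 ?posrE ?ltr0n ?quota_gt0 // ler_nat leq_quota.
Qed.

Lemma sum_price s n gamma j : (0 < j <= s)%N ->
  \sum_(j <= l < s.+1) (price s n gamma l - price s n gamma l.+1)
  = price s n gamma j.
Proof.
move=> /andP[j0 js]; under eq_bigr do rewrite -opprB.
rewrite sumrN telescope_sumr 1?ltnW // opprB.
by rewrite {2}/price ltnn subr0.
Qed.

(** Summation by parts, with no boundary term because the price vanishes at
    [s.+1]. *)
Lemma S2_price gamma c s n : 0 <= gamma < 1 -> (0 < n <= s)%N ->
  n%:R * \sum_(1 <= j < s.+1) (price s n gamma j - price s n gamma j.+1) * c j
  = S2 gamma c s n.
Proof.
move=> g01 ns; rewrite S2E // sum_by_parts; last by lia.
rewrite {2}/price ltnn mul0r subr0; congr (_ * _).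
rewrite [RHS]big_mkcond; apply: eq_big_nat => j /andP[j0 js].
by rewrite /price -ltnS js /=; case: ifP => _; rewrite ?mul0r // mulrC.
Qed.

(** At the rank [j] of the event, at least [quota j] true nulls are charged at
    least [price j = 1 / quota j] each, the inner sum telescoping from the
    first critical value above the p-value. *)
Lemma FDP_certificate s gamma c (q : 'I_s -> R) (I : {set 'I_s}) :
    0 <= gamma -> (forall i j, (1 <= i <= j)%N -> (j <= s)%N -> c i <= c j) ->
    gamma < FDP I (stepup c q) ->
  1 <= \sum_(i in I) \sum_(1 <= l < s.+1)
    (price s #|I| gamma l - price s #|I| gamma l.+1) * (q i <= c l)%R%:R.
Proof.
move=> g0 cnd /(FDP_gt_quota g0)[j /andP[j0 js] [mn qn]].
have d0 l : 0 <= price s #|I| gamma l - price s #|I| gamma l.+1.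
  by rewrite subr_ge0 price_nonincreasing.
have row0 i : 0 <= \sum_(1 <= l < s.+1)
    (price s #|I| gamma l - price s #|I| gamma l.+1) * (q i <= c l)%R%:R.
  by apply: sumr_ge0 => l _; rewrite mulr_ge0.
have row i : q i <= c j -> price s #|I| gamma j <= \sum_(1 <= l < s.+1)
    (price s #|I| gamma l - price s #|I| gamma l.+1) * (q i <= c l)%R%:R.
  move=> qj; rewrite (@big_cat_nat _ _ _ j) //=; last exact: leqW.
  rewrite ler_wpDl ?sumr_ge0 // => [l _|]; first by rewrite mulr_ge0.
  rewrite -(@sum_price s #|I| gamma j) ?j0 // le_eqVlt; apply/orP; left; apply/eqP.
  apply: eq_big_nat => l /andP[jl ls].
  by rewrite (le_trans qj) ?mulr1 // cnd // j0.
rewrite (bigID (fun i => q i <= c j)) /= ler_wpDr ?sumr_ge0 //.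
apply: (@le_trans _ _ (\sum_(i in I | q i <= c j) price s #|I| gamma j)); last first.
  by apply: ler_sum => i /andP[_]; exact: row.
rewrite sumr_const -(mulr_natr (price _ _ _ _)) /price js mn /=.
rewrite ler_pdivlMl ?mulr1 ?ltr0n ?quota_gt0 // ler_nat.
by apply: leq_trans qn _; rewrite cardsE.
Qed.

Local Open Scope classical_set_scope.
Local Open Scope ereal_scope.

(** Markov's inequality for a nonnegative combination of indicators. *)
Lemma probability_le_weighted {d} {T : measurableType d} (P : probability T R)
    (K : Type) (r : seq K) (w : K -> R) (A : set T) (B : K -> set T) :
    (forall k, 0 <= w k)%R -> measurable A -> (forall k, measurable (B k)) ->
    (forall t, A t -> 1 <= \sum_(k <- r) w k * (\1_(B k) t))%R ->
  P A <= \sum_(k <- r) (w k)%:E * P (B k).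
Proof.
move=> w0 mA mB AB.
have mw k : measurable_fun setT (fun t => (w k)%:E * (\1_(B k) t)%:E).
  by apply: measurable_funeM; apply/measurable_EFinP; exact: measurable_indic.
have ge0 k t : setT t -> 0 <= (w k)%:E * (\1_(B k) t)%:E.
  by move=> _; rewrite -EFinM lee_fin mulr_ge0.
rewrite -[A]setIT -integral_indic //.
under eq_bigr => k _.
  rewrite -[B k]setIT -integral_indic // -ge0_integralZl //; last 2 first.
  - by apply/measurable_EFinP; exact: measurable_indic.
  - by rewrite lee_fin.
  over.
rewrite -ge0_integral_sum //; apply: ge0_le_integral => //.
- by apply/measurable_EFinP; exact: measurable_indic.
- by apply: emeasurable_sum.
move=> t _; under eq_bigr do rewrite -EFinM.
rewrite sumEFin lee_fin [leLHS]indicE.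
case: (boolP (t \in A)) => [/set_mem/AB //|_].
by apply: sumr_ge0 => k _; rewrite mulr_ge0.
Qed.

(** Zero is a possible critical value, hence the extension of the hypothesis on
    p-values from the open unit interval; at [0] it follows by a limit from the
    right. *)
Lemma pvalue_le {d} {T : measurableType d} (P : probability T R)
    (p : {mfun T >-> R}) :
    (forall u : R, (0 < u < 1)%R -> P [set t | (p t <= u)%R] <= u%:E) ->
  forall u : R, (0 <= u)%R -> P [set t | (p t <= u)%R] <= u%:E.
Proof.
move=> Pu u u0.
have mp v : measurable [set t | (p t <= v)%R].
  by rewrite -[X in measurable X]setTI; apply: (measurable_fun_le (g := cst v)).
have [u1|u1] := leP 1%R u.
  by apply: (le_trans (probability_le1 P (mp u))); rewrite lee_fin.
apply/lee_addgt0Pr => e e0; pose v : R := Num.min (u + e)%R ((u + 1) / 2)%R.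
have [uv ve v1] : [/\ u < v, v <= u + e & v < 1]%R.
  by rewrite lt_min gt_min ge_min lexx ltrDl e0 !midf_lt ?orbT.
have v01 : (0 < v < 1)%R by rewrite v1 (le_lt_trans u0).
apply: (@le_trans _ _ (P [set t | (p t <= v)%R])).
  apply: le_measure; rewrite ?inE //.
  by move=> t /= /le_trans; apply; exact: ltW.
by apply: le_trans (Pu _ v01) _; rewrite -EFinD lee_fin.
Qed.

Lemma stepup_FDP_le {d} {T : measurableType d} (P : probability T R) s gamma c
    (p : 'I_s -> {mfun T >-> R}) (I : {set 'I_s}) :
    (0 <= gamma < 1)%R -> (0 <= c 1%N)%R ->
    (forall i j, (1 <= i <= j)%N -> (j <= s)%N -> (c i <= c j)%R) ->
    (0 < #|I|)%N ->
    (forall i, i \in I -> forall u : R, (0 < u < 1)%R ->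
       P [set t | (p i t <= u)%R] <= u%:E) ->
  P [set t | (gamma < FDP I (stepup c (fun i => p i t)))%R]
    <= (S2 gamma c s #|I|)%:E.
Proof.
move=> g01 c1 cnd I0 pI; have /andP[g0 _] := g01.
have Is : (0 < #|I| <= s)%N by rewrite I0 -[leqRHS]card_ord max_card.
set w := fun l => (price s #|I| gamma l - price s #|I| gamma l.+1)%R.
have w0 l : (0 <= w l)%R by rewrite subr_ge0 price_nonincreasing.
pose K := [seq (i, l) | i <- enum I, l <- index_iota 1 s.+1].
pose B (k : 'I_s * nat) := [set t | (p k.1 t <= c k.2)%R].
have mB k : measurable (B k).
  by rewrite -[X in measurable X]setTI; apply: (measurable_fun_le (g := cst _)).
apply: (@le_trans _ _ (\sum_(k <- K) (w k.2)%:E * P (B k))).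
  apply: probability_le_weighted => // [|t].
    exact: (measurable_stepup c p (fun A => gamma < FDP I A)%R).
  move=> /= /(FDP_certificate g0 cnd) /le_trans; apply.
  rewrite big_allpairs big_enum /=; apply: ler_sum => i _; apply: ler_sum => l _.
  by rewrite indicE /B mem_setE.
rewrite big_allpairs big_enum /= -(S2_price c g01 Is).
apply: (@le_trans _ _ (\sum_(i in I) \sum_(1 <= l < s.+1) (w l * c l)%:E)).
  apply: lee_sum => i iI; rewrite big_nat [leRHS]big_nat.
  apply: lee_sum => l /andP[l1 ls].
  rewrite EFinM lee_wpmul2l ?lee_fin //; apply: pvalue_le; first exact: pI.
  by rewrite (le_trans c1) // cnd.
under eq_bigr do rewrite sumEFin.
by rewrite sumEFin lee_fin sumr_const mulr_natl.
Qed.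

End UpperBound.

(** * The least favourable model *)

Section OrdinalCounts.

Lemma card_ord_narrow (n s : nat) (Q : pred nat) : (n <= s)%N ->
  #|[set i : 'I_s | Q i && (i < n)%N]%SET| = #|[set i : 'I_n | Q i]%SET|.
Proof.
by move=> ns; rewrite -!sum1dep_card (big_ord_narrow_cond ns).
Qed.

Lemma card_ord_lt (n s : nat) : (n <= s)%N -> #|[set i : 'I_s | (i < n)%N]%SET| = n.
Proof.
by move=> ns; rewrite -[RHS]card_ord -cardsT -[in RHS](@card_ord_narrow n s xpredT) //.
Qed.

Lemma card_rotation (n b i : nat) : (0 < n)%N -> (b <= n)%N ->
  #|[set r : 'I_n | ((i + r) %% n < b)%N]%SET| = b.
Proof.
case: n => // n _ bn; rewrite -[RHS](@card_ord_lt b n.+1) //.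
have inj : injective (fun r : 'I_n.+1 => inZp i + r) by exact: addrI.
rewrite -[RHS](on_card_preimset (onW_bij _ (injF_bij inj))).
by apply: eq_card => r; rewrite !inE /= modnDml.
Qed.

End OrdinalCounts.

Section FiniteModel.
Context {R : realType}.
Implicit Types (gamma : R) (c : nat -> R).

Definition first_hyps (s n : nat) : {set 'I_s} := [set i : 'I_s | (i < n)%N]%SET.

(** As [r] runs through the [n] rotations, each of the first [n] hypotheses is
    rejected equally often, namely [b] times.  The other [j - b] rejections
    are placed among the false nulls, whose p-values have free marginals. *)
Definition rejections (s n b j r : nat) : {set 'I_s} :=
  [set i : 'I_s |
    if (i < n)%N then ((i + r) %% n < b)%N else (i < n + (j - b))%N]%SET.

Lemma card_rejections_first s n b j r : (0 < n <= s)%N -> (b <= n)%N ->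
  #|rejections s n b j r :&: first_hyps s n| = b.
Proof.
move=> /andP[n0 ns] bn.
rewrite -[RHS](@card_rotation n b r) //.
rewrite -(@card_ord_narrow n s (fun i => (r + i) %% n < b)%N) //.
apply: eq_card => i; rewrite !inE (addnC r).
by case: ltnP; rewrite ?andbF.
Qed.

Lemma card_rejections s n b j r : (0 < n <= s)%N -> (b <= n)%N -> (b <= j)%N ->
  (n + j - s <= b)%N -> #|rejections s n b j r| = j.
Proof.
move=> ns bn bj njs; have /andP[n0 ns'] := ns.
rewrite -(cardsID (first_hyps s n)) card_rejections_first //.
have -> : rejections s n b j r :\: first_hyps s n =
    first_hyps s (n + (j - b)) :\: first_hyps s n.
  by apply/setP => i; rewrite !inE; case: ifP.
have := cardsID (first_hyps s n) (first_hyps s (n + (j - b))).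
have -> : first_hyps s (n + (j - b)) :&: first_hyps s n = first_hyps s n.
  by apply/setP => i; rewrite !inE; lia.
by rewrite !card_ord_lt; lia.
Qed.

(** Keeps the marginals of the least favourable model valid: the increments up
    to the last critical value not exceeding [u] telescope to that value. *)
Lemma sum_incr_le c (u : R) s : 0 <= u -> 0 <= c 1%N ->
    (forall i j, (1 <= i <= j)%N -> (j <= s)%N -> c i <= c j) ->
  \sum_(1 <= j < s.+1 | c j <= u) incr c j <= u.
Proof.
move=> u0 c1 cnd.
suff [] : \sum_(1 <= j < s.+1 | c j <= u) incr c j <= u /\
    ((0 < s)%N -> \sum_(1 <= j < s.+1 | c j <= u) incr c j <= c s) by [].
elim: s cnd => [|s IH] cnd; first by rewrite big_geq.
have [IHu IHc] := IH (fun i j ij js => cnd i j ij (leqW js)).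
rewrite big_mkcond big_nat_recr //= -big_mkcond /=.
have [-> {IH IHu IHc}|s0] := posnP s.
  by rewrite big_geq // add0r /incr subr0; case: ifP.
have cs : c s <= c s.+1 by apply: cnd => //; rewrite s0 /=.
have {}IHc := IHc s0; rewrite /incr gtn_eqF //=.
by case: ifP => h; split=> [|_]; lra.
Qed.

(** The configuration [(l, r)] of rank [j = l.+1] rejects exactly [j] hypotheses,
    with as few true ones among them as the quota allows; the rotation [r]
    spreads the false rejections evenly over the true nulls.  The
    configuration [None] absorbs the remaining mass and rejects nothing. *)
Definition config_pval (s n : nat) gamma c (k : option ('I_s * 'I_n))
    (i : 'I_s) : R :=
  if k isn't Some (l, r) then 1 + c s else
  if i \in rejections s n (quota s n gamma l.+1) l.+1 r then c l.+1
  else 1 + c s.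

Definition config_mass (s n : nat) gamma c (j : nat) : R :=
  if (min_false gamma j <= n)%N then incr c j / (quota s n gamma j)%:R else 0.

Lemma config_FDP s n gamma c (l : 'I_s) (r : 'I_n) :
    0 <= gamma < 1 -> (0 < n <= s)%N ->
    (forall i j, (1 <= i <= j)%N -> (j <= s)%N -> c i <= c j) ->
    (min_false gamma l.+1 <= n)%N ->
  gamma < FDP (first_hyps s n) (stepup c (config_pval gamma c (Some (l, r)))).
Proof.
move=> g01 ns cnd mn; have /andP[g0 _] := g01; have /andP[n0 ns'] := ns.
set b := quota s n gamma l.+1; set A := rejections s n b l.+1 r.
have bn : (b <= n)%N by exact: quota_leq_nulls.
have bj : (b <= l.+1)%N by exact: quota_le.
have bs : (n + l.+1 - s <= b)%N by rewrite /b /quota leq_maxl.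
have cA : #|A| = l.+1 by exact: card_rejections.
rewrite (@stepup_eq _ _ _ _ A) ?cA //.
- by rewrite FDP_gt // cA card_rejections_first // /b /quota leq_maxr.
- by move=> i iA; rewrite /config_pval -/b -/A iA.
move=> i j iA /andP[lj js]; rewrite /config_pval -/b -/A (negbTE iA).
by rewrite ltr_pwDl // cnd // js (leq_trans _ lj).
Qed.

(** The total mass of the configurations violating FDP <= gamma would be [S2],
    which may exceed [1]; the masses are then scaled down, which keeps the
    marginals valid and leaves a violation of probability [1]. *)
Lemma finite_least_favourable s n gamma c :
    0 <= gamma < 1 -> (0 < n <= s)%N -> 0 <= c 1%N ->
    (forall i j, (1 <= i <= j)%N -> (j <= s)%N -> c i <= c j) ->
  exists (K : finType) (w : K -> R) (q : K -> 'I_s -> R),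
  [/\ forall k, 0 <= w k, \sum_k w k = 1,
      forall i u, i \in first_hyps s n -> 0 < u < 1 ->
        \sum_(k | q k i <= u) w k <= u
    & Num.min 1 (S2 gamma c s n) <=
      \sum_(k | gamma < FDP (first_hyps s n) (stepup c (q k))) w k].
Proof.
move=> g01 ns c1 cnd; have /andP[g0 _] := g01; have /andP[n0 ns'] := ns.
have s0 : (0 < s)%N by exact: leq_trans ns'.
have cs : 0 <= c s by rewrite (le_trans c1) // cnd ?s0.
set S := S2 gamma c s n; pose lam : R := (Num.max 1 S)^-1.
pose m := config_mass s n gamma c.
have incr0 (l : 'I_s) : 0 <= incr c l.+1.
  exact: (incr_ge0 c1 cnd (ltn_ord l : (0 < l.+1 <= s)%N)).
have m0 (l : 'I_s) : 0 <= m l.+1.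
  rewrite /m /config_mass; case: ifP => // _.
  by rewrite divr_ge0.
have SE : S = \sum_(l < s) \sum_(r < n) m l.+1.
  rewrite /S S2E // big_add1 big_mkord /= big_mkcond mulr_sumr.
  by apply: eq_bigr => l _; rewrite sumr_const card_ord mulr_natl.
have S0 : 0 <= S by rewrite SE; do 2!apply: sumr_ge0 => ? _.
have lam0 : 0 <= lam by rewrite invr_ge0 le_max ler01.
have lam1 : lam <= 1 by rewrite invf_le1 ?lt_max ?ltr01 // le_max lexx.
have lamS : lam * S = Num.min 1 S.
  by rewrite /lam; case: leP => [S1|S1]; rewrite ?invr1 ?mul1r //
    mulVf // gt_eqF // (lt_le_trans _ S1).
pose w (k : option ('I_s * 'I_n)) :=
  if k is Some (l, r) then lam * m l.+1 else 1 - lam * S.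
have sumK (F : option ('I_s * 'I_n) -> R) :
    \sum_k F k = F None + \sum_(l < s) \sum_(r < n) F (Some (l, r)).
  rewrite (bigD1 None) //= (reindex_omap Some id) => [|[]] //=.
  rewrite pair_big; congr (_ + _); apply: eq_big => [[l r]|[l r] _] //=.
  by rewrite eqxx.
exists (option ('I_s * 'I_n)), w, (config_pval gamma c); split.
- case=> [[l r]|] /=; first by rewrite mulr_ge0.
  by rewrite subr_ge0 lamS ge_min lexx.
- rewrite sumK /= SE !mulr_sumr; under [X in _ + X]eq_bigr do rewrite -mulr_sumr.
  by rewrite subrK.
- move=> i u; rewrite inE => i_n /andP[u0 u1]; rewrite big_mkcond sumK /=.
  (* The p-values [1 + c s] exceed [1], hence [u]. *)
  have M : (1 + c s <= u) = false by apply/negbTE; rewrite -ltNge; lra.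
  rewrite M add0r.
  apply: le_trans (@sum_incr_le c u s (ltW u0) c1 cnd).
  rewrite big_add1 big_mkord /= [leRHS]big_mkcond /=; apply: ler_sum => l _.
  set b := quota s n gamma l.+1.
  (* Each true null is rejected in [b] of the [n] rotations. *)
  have -> : \sum_(r < n) (if config_pval gamma c (Some (l, r)) i <= u
        then lam * m l.+1 else 0) =
      (if c l.+1 <= u then
       lam * m l.+1 * #|[set r : 'I_n | ((i + r) %% n < b)%N]%SET|%:R else 0).
    case: ifP => cu; last first.
      apply: big1 => r _; rewrite /config_pval.
      by case: (i \in _); rewrite ?cu ?M.
    rewrite mulr_natr -sumr_const [RHS]big_mkcond; apply: eq_bigr => r _ /=.
    by rewrite /config_pval !inE i_n -/b; case: (_ < b)%N; rewrite ?cu ?M.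
  case: ifP => // _; rewrite /m /config_mass -/b.
  case: ifP => mn; last by rewrite mulr0 mul0r.
  rewrite card_rotation //; last exact: quota_leq_nulls.
  rewrite -mulrA divfK ?pnatr_eq0 -?lt0n ?quota_gt0 //.
  by rewrite ler_piMl.
- rewrite big_mkcond sumK /= -lamS ler_wpDl //.
    by case: ifP => // _; rewrite subr_ge0 lamS ge_min lexx.
  rewrite [in leLHS]SE mulr_sumr; apply: ler_sum => l _.
  rewrite mulr_sumr; apply: ler_sum => r _.
  rewrite /m /config_mass; case: (boolP (_ <= n)%N) => [mn|_]; last first.
    by rewrite mulr0; case: ifP.
  by rewrite config_FDP // mn.
Qed.

End FiniteModel.

Section Realization.
Context {R : realType}.

Lemma finite_probability {d} {T : measurableType d} (K : finType) (x : K -> T)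
    (w : K -> R) : (forall k, 0 <= w k) -> \sum_k w k = 1 ->
  exists P : probability T R,
    forall A : set T, P A = (\sum_(k | x k \in A) w k)%:E.
Proof.
move=> w0 w1.
pose m (i : nat) : {measure set T -> \bar R} :=
  if insub i : option 'I_#|K| is Some k
  then mscale (NngNum (w0 (enum_val k))) (dirac (x (enum_val k)))
  else mzero.
have mE A : msum m #|K| A = (\sum_(k | x k \in A) w k)%:E.
  rewrite /msum -sumEFin [RHS]big_mkcond [RHS](reindex (@enum_val K K)) /=;
    last exact/onW_bij/enum_val_bij.
  apply: eq_bigr => i _; rewrite /m valK /= /mscale /= diracE.
  by case: (_ \in A); rewrite ?mule1 ?mule0.
have mT : msum m #|K| setT = 1%E.
  by rewrite mE; under eq_bigl do rewrite in_setT; rewrite w1.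
pose is_prob := Measure_isProbability.Build _ _ _ (msum m #|K|) mT.
pose P : probability T R := HB.pack (msum m #|K|) is_prob.
by exists P.
Qed.

(** The hypotheses are chosen so that the only distribution of the model makes
    exactly the first [n] of them true. *)
Lemma stepup_controls_S2 s gamma alpha (c : nat -> R) :
    0 <= gamma < 1 -> alpha < 1 -> 0 <= c 1%N ->
    (forall i j, (1 <= i <= j)%N -> (j <= s)%N -> c i <= c j) ->
    stepup_controls_FDP s gamma alpha c ->
  forall n, (0 < n <= s)%N -> S2 gamma c s n <= alpha.
Proof.
move=> g01 alpha1 c1 cnd control n ns.
have [K [w [q [w0 w1 pq minS]]]] := finite_least_favourable g01 ns c1 cnd.
have [P PE] := finite_probability (pickle : K -> nat) w0 w1.
pose f i (t : nat) : R := oapp (q^~ i) 0 (unpickle t).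
have mf i : measurable_fun setT (f i) by [].
pose p i : {mfun nat >-> R} :=
  HB.pack (f i) (isMeasurableFun.Build _ _ _ _ (f i) (mf i)).
pose Omega : set (probability nat R) := [set P]%classic.
pose omega (i : 'I_s) : set (probability nat R) :=
  if (i < n)%N then Omega else set0.
have fK i k : f i (pickle k) = q k i by rewrite /f pickleK.
have pickle_sum (Q : ('I_s -> R) -> bool) :
    P [set t | Q (fun i => f i t)]%classic = (\sum_(k | Q (q k)) w k)%:E.
  rewrite PE; congr (_%:E); apply: eq_bigl => k.
  rewrite mem_setE /=; congr (Q _); apply/funext => i; exact: fK.
have nulls : true_nulls omega P = first_hyps s n.
  apply/setP => i; rewrite !inE /omega; case: ifP => _; apply/asboolP => //=.
have := control _ _ Omega omega p _ _ P erefl.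
rewrite nulls (pickle_sum (fun x => gamma < FDP (first_hyps s n) (stepup c x))).
rewrite lee_fin => /(_ _ _)/(le_trans minS) h.
(* As [alpha < 1], the minimum cannot be [1]. *)
suff : Num.min 1 (S2 gamma c s n) <= alpha.
  by rewrite ge_min leNgt alpha1.
apply: h => [i P'|i P']; rewrite /omega; first by case: ifP.
case: ifP => // i_n -> u u01.
rewrite (pickle_sum (fun x => x i <= u)) lee_fin pq //.
by rewrite inE.
Qed.

End Realization.

(** * Optimality of the constant *)

Section Positivity.
Context {R : realType} (gamma : R) (a : nat -> R) (s : nat)
  (gamma01 : 0 <= gamma < 1) (a1_ge0 : 0 <= a 1%N)
  (a_nd : forall i j : nat, (1 <= i <= j)%N -> (j <= s)%N -> a i <= a j).

Lemma S2_ge0 n : (0 < n <= s)%N -> 0 <= S2 gamma a s n.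
Proof.
move=> ns; rewrite S2E // mulr_ge0 // big_nat_cond.
apply: sumr_ge0 => j; rewrite ltnS => /andP[js _]; rewrite divr_ge0 //.
exact: (incr_ge0 a1_ge0 a_nd js).
Qed.

(** When all hypotheses are true every rank enters the sum, and no quota
    exceeds [s]. *)
Lemma le_S2_all_true : (0 < s)%N -> a s <= S2 gamma a s s.
Proof.
move=> s0; rewrite S2E ?s0 ?leqnn // -(sum_incr a s0).
rewrite mulr_sumr [leRHS]big_mkcond; apply: ler_sum_nat => j; rewrite ltnS => js.
have /andP[j0 js'] := js.
rewrite ifT ?(leq_trans (min_false_le gamma01 j0)) //.
rewrite mulrCA ler_peMr ?(incr_ge0 a1_ge0 a_nd js) //.
rewrite ler_pdivlMr ?ltr0n ?quota_gt0 // mul1r ler_nat.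
by rewrite (leq_trans (quota_le gamma01 _ j0)).
Qed.

Lemma D2_ge0 : (0 < s)%N -> 0 <= D2 gamma a s.
Proof.
by move=> s0; apply: le_trans (S2_ge0 (n := 1) _) (S2_le_D2 _ _ _); rewrite s0.
Qed.

Lemma D2_gt0 i : (1 <= i <= s)%N -> 0 < a i -> 0 < D2 gamma a s.
Proof.
move=> /andP[i1 i_s] ai; have s0 : (0 < s)%N by exact: leq_trans i_s.
have ss : (0 < s <= s)%N by rewrite s0 /=.
apply: lt_le_trans ai (le_trans (a_nd _ (leqnn s)) _); first by rewrite i1.
exact: le_trans (le_S2_all_true s0) (S2_le_D2 gamma a ss).
Qed.

End Positivity.

Theorem theorem4p1 (R : realType) (s : nat) (gamma alpha : R) (a : nat -> R)
  (s_gt0 : (0 < s)%N)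
  (gamma01 : 0 <= gamma <= 1)
  (alpha01 : 0 < alpha < 1)
  (a1_ge0 : 0 <= a 1%N)
  (a_nondecreasing : forall i j : nat, (1 <= i <= j)%N -> (j <= s)%N -> a i <= a j) :
  stepup_controls_FDP s gamma alpha (fun i => alpha * a i / D2 gamma a s)
  /\
  (gamma < 1 ->
   forall D' : R, D' != 0 ->
     stepup_controls_FDP s gamma alpha (fun i => alpha * a i / D') ->
     forall i : nat, (1 <= i <= s)%N ->
       alpha * a i / D2 gamma a s >= alpha * a i / D').
Proof.
have /andP[g0 g1] := gamma01; have /andP[alpha0 alpha1] := alpha01.
have rescale x : (fun i => alpha * a i / x) = (fun i => alpha / x * a i).
  by apply/funext => i; rewrite mulrAC.
have scaled_nd x : 0 <= x ->
    forall i j : nat, (1 <= i <= j)%N -> (j <= s)%N -> x * a i <= x * a j.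
  by move=> x0 i j ij js; rewrite ler_wpM2l ?a_nondecreasing.
split.
  move=> d T Omega omega p _ pval P _.
  set I := true_nulls omega P; set c := fun i => alpha * a i / D2 gamma a s.
  have pI i : i \in I -> forall u : R, 0 < u < 1 ->
      (P [set t | (p i t <= u)%R]%classic <= u%:E)%E.
    by rewrite inE => /asboolP; exact: pval.
  have never : (forall t, FDP I (stepup c (fun i => p i t)) <= gamma) ->
      (P [set t | (gamma < FDP I (stepup c (fun i => p i t)))%R]%classic
         <= alpha%:E)%E.
    move=> le; rewrite (_ : [set t | _]%classic = set0).
      by rewrite measure0 lee_fin ltW.
    by apply/seteqP; split=> t //=; rewrite ltNge le.
  (* For gamma = 1 the first term of [S2] is not a summand of index [1], since
     then [min_false gamma 1 = 2]; but the FDP never exceeds 1. *)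
  have [g1'|g1'] := ltP gamma 1; last first.
    by apply: never => t; rewrite (le_trans (FDP_le1 _ _)).
  have g01 : 0 <= gamma < 1 by rewrite g0.
  have [I0|I0] := posnP #|I|.
    by apply: never => t; rewrite leNgt FDP_gt // (cards0_eq I0) finset.setI0 cards0.
  have Is : (0 < #|I| <= s)%N by rewrite I0 -[leqRHS]card_ord max_card.
  have D0 := D2_ge0 g01 a1_ge0 a_nondecreasing s_gt0.
  have x0 : 0 <= alpha / D2 gamma a s by rewrite divr_ge0 // ltW.
  rewrite /c rescale.
  apply: le_trans (stepup_FDP_le g01 _ (scaled_nd _ x0) I0 pI) _.
    by rewrite mulr_ge0.
  rewrite lee_fin S2_scale.
  (* Division by zero makes all critical values vanish when D2 does. *)
  have [->|Dn0] := eqVneq (D2 gamma a s) 0; first by rewrite invr0 mulr0 mul0r ltW.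
  rewrite -mulrA ger_pMr // ler_pdivrMl ?mulr1 ?S2_le_D2 //.
  by rewrite lt_def Dn0.
move=> g1' D' D'n0 control i i_s; have g01 : 0 <= gamma < 1 by rewrite g0.
have ai0 : 0 <= a i.
  by case/andP: i_s => i1 i_s; rewrite (le_trans a1_ge0) // a_nondecreasing.
have D0 := D2_ge0 g01 a1_ge0 a_nondecreasing s_gt0.
rewrite -!mulrA ler_wpM2l ?(ltW alpha0) //.
have [D'0|D'0] := leP D' 0.
  by rewrite (@le_trans _ _ 0) ?divr_ge0 // mulr_ge0_le0 // invr_le0.
have x0 : 0 <= alpha / D' by rewrite divr_ge0 // ltW.
have DD' : D2 gamma a s <= D'.
  apply: D2_le => // n ns; rewrite rescale in control.
  have := stepup_controls_S2 g01 alpha1 _ (scaled_nd _ x0) control ns.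
  rewrite S2_scale -mulrA ger_pMr // ler_pdivrMl // mulr1; apply.
  by rewrite mulr_ge0.
have [->|ain0] := eqVneq (a i) 0; first by rewrite !mul0r.
rewrite ler_wpM2l // lef_pV2 ?posrE //.
by apply: (D2_gt0 g01 a1_ge0 a_nondecreasing i_s); rewrite lt_def ain0.
Qed.
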